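(* Let $A(S,k)$ be the expected number of surviving ancestors in a uniform descendancy diagram with $k-1$ levels, each of width $S$. Let the sequence $a_i=a_{S,i}$ be defined by $a_{S,0}=1$ and $a_{S,i+1}=1-\left(1-\frac1S\right)^{a_{S,i}S}$. Then $$A(S,k)\;\le\; a_{k}\,S,$$ where $a_k=a_{S,k}$.
   Context: Here $S$ is the sample size and $k$ is the number of districts. A uniform descendancy diagram $D$ with parameters $S,k$ has levels (also called layers or generations) labeled $i=1$ to $k-1$ from bottom to top, each consisting of $S$ nodes. Each node below the top level chooses a parent uniformly at random (independently of the other nodes) from the $S$ nodes of the level immediately above. A node is active if it has a descendant in the bottom level (level $1$), and all $S$ nodes of level $1$ count as active. The surviving ancestors of $D$ are the active nodes at the top level $k-1$, and their number is denoted $A(D)$. $A(S,k)=\mathbb{E}[A(D)]$ is the expected number of surviving ancestors as $D$ ranges over the uniform distribution on the set of such diagrams. Equivalently, if $X_i$ is the number of active nodes at level $i$, so that $X_1\equiv S$, then $A(S,k)=\mathbb{E}[X_{k-1}]$.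
   Formalization: The bound is proved with a_{k-2} in place of a_k: as printed it fails, e.g. for S=k=2, where A(2,2)=2 but a_2·2≈1.29; since X_1=S=a_0 S, the recursion gives A(S,k)=E[X_{k-1}] ≤ a_{k-2} S. *)

(* Defs.v *)
From mathcomp Require Import all_boot all_order all_algebra.
From mathcomp Require Import reals exp.

Set Implicit Arguments.
Unset Strict Implicit.
Unset Printing Implicit Defensive.

Import Order.TTheory GRing.Theory Num.Theory.
Local Open Scope ring_scope.

(* The levels 1, ..., k-1 are numbered from 0 here: the pair (i, x) is the
   x-th node of level i+1, so 0 is the bottom level and k-2 the top one. *)
Notation node S k := ('I_k.-1 * 'I_S)%type.

(* Only the levels below the top choose parents: for i < k-2, D i x is the
   position, in the level just above, of the parent of the node (i, x). *)
Notation diagram S k := {ffun 'I_k.-2 -> {ffun 'I_S -> 'I_S}}.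

Definition is_parent (S k : nat) (D : diagram S k) : rel (node S k) :=
  fun u v => [exists i : 'I_k.-2,
    [&& u.1 == i :> nat, v.1 == i.+1 :> nat & v.2 == D i u.2]].

(* The relation connect is reflexive, so every bottom node is active. *)
Definition active (S k : nat) (D : diagram S k) : pred (node S k) :=
  fun v => [exists u : node S k,
    (u.1 == 0%N :> nat) && connect (is_parent D) u v].

Definition surviving_ancestors (S k : nat) (D : diagram S k) :
    {set node S k} :=
  [set v : node S k | (v.1 == k.-2 :> nat) && active D v].

Definition expected_survivors (R : realType) (S k : nat) : R :=
  (\sum_(D : diagram S k) #|surviving_ancestors D|%:R)
    / #|{: diagram S k}|%:R.

(* a_seq R S 0 = 1 bounds the fraction of active nodes at the bottom level, so
   the index counts the generations above the bottom: the top level k-1 is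
   matched by index k-2. Index k would give a false bound: for S = k = 2 the
   expected number of survivors is 2, whereas a_seq R 2 2 * 2 < 2. *)
Fixpoint a_seq (R : realType) (S i : nat) : R :=
  if i is j.+1 then 1 - (1 - S%:R^-1) `^ (a_seq R S j * S%:R) else 1.

(* Main.v *)
(* Given the active set A of a level, a node of the next level fails to be
   active with probability q ^ #|A|, where q = 1 - 1/S, so the next level has
   S (1 - q ^ #|A|) active nodes on average. As x |-> q ^ x is convex and
   nonincreasing, Jensen's inequality yields the recursion of a_seq, by
   induction on the level. *)

Require Import Defs.
From mathcomp Require Import all_boot all_order all_algebra.
From mathcomp Require Import reals exp.
Local Open Scope ring_scope.

Import Order.TTheory GRing.Theory Num.Theory.

Section ActiveSets.
Context {S n : nat}.
Implicit Types (D : diagram S n.+2) (m : nat).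

(* The union has at most one term; it is empty when j >= n. *)
Fixpoint active_set D m : {set 'I_S} :=
  if m is j.+1 then \bigcup_(i : 'I_n | i == j :> nat) (D i @: active_set D j)
  else setT.

Lemma active_setS D (i : 'I_n) :
  active_set D i.+1 = D i @: active_set D i.
Proof.
rewrite /=; apply: big_pred1 => j /=.
by rewrite -val_eqE.
Qed.

(** Along a path from the bottom level, membership passes from each node to its parent. Conversely,
    a point of the image is the parent of a member one level below, and the path reaching that
    member extends by one edge. *)
Lemma mem_active_set D (v : node S n.+2) :
  active D v = (v.2 \in active_set D v.1).
Proof.
apply/idP/idP.
  case/existsP => u /andP[/eqP u0 /connectP[p]].
  have : u.2 \in active_set D u.1 by rewrite u0 inE.
  elim: p u {u0} => [|w p IHp] u u_act /=; first by move=> _ ->.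
  case/andP=> /existsP[i /and3P[/eqP ui /eqP wi /eqP w2]]; apply: IHp.
  by rewrite wi active_setS w2 imset_f // -ui.
case: v => [[m ltm] x] /=.
elim: m ltm x => [|m IHm] ltm x xA.
  by apply/existsP; exists (Ordinal ltm, x); rewrite eqxx connect0.
pose i : 'I_n := Ordinal (ltm : (m < n)%N).
move: xA; rewrite (active_setS D i) => /imsetP[y yA ->].
have /existsP[u /andP[u0 uy]] := IHm (ltnW ltm) y yA.
apply/existsP; exists u; rewrite u0 /=; apply: connect_trans uy (connect1 _).
by apply/existsP; exists i; rewrite /= !eqxx.
Qed.

Lemma card_surviving_ancestors D :
  #|surviving_ancestors D| = #|active_set D n|.
Proof.
have -> : surviving_ancestors D =
    [set (ord_max : 'I_n.+1, x) | x in active_set D n].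
  apply/setP => -[i x]; rewrite inE mem_active_set /=.
  apply/andP/imsetP => [[/eqP in_ xA] | [y yA [-> ->]]]; last by [].
  by exists x; [rewrite -in_ | congr pair; apply: val_inj].
by rewrite card_imset // => x y [].
Qed.

(** Serves as the independence statement: resampling the choices [D m] leaves [active_set D m]
    unchanged. *)
Lemma eq_active_set D D' m :
  (forall i : 'I_n, (i < m)%N -> D i = D' i) ->
  active_set D m = active_set D' m.
Proof.
elim: m => //= m IHm eqD.
rewrite IHm => [|i ltim]; last by apply: eqD; apply: ltnW.
by apply: eq_bigr => i /eqP im; rewrite eqD // im.
Qed.

End ActiveSets.

Section Resampling.
Context {R : pzSemiRingType} {I T : finType}.

Definition ffun_upd (D : {ffun I -> T}) (i : I) (t : T) : {ffun I -> T} :=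
  [ffun j => if j == i then t else D j].

(* (D, t) |-> (D with value t at i, D i) is an involution. *)
Lemma sum_ffun_upd (i : I) (h : {ffun I -> T} -> R) :
  \sum_D \sum_t h (ffun_upd D i t) = \sum_D h D *+ #|T|.
Proof.
rewrite pair_big /=.
transitivity (\sum_(p : {ffun I -> T} * T) h p.1); last first.
  rewrite -(pair_big xpredT xpredT (fun D (_ : T) => h D)) /=.
  by apply: eq_bigr => D _; rewrite sumr_const.
pose sw (p : {ffun I -> T} * T) := (ffun_upd p.1 i p.2, p.1 i).
have swK : involutive sw.
  case=> D t; rewrite /sw /= ffunE eqxx; congr pair.
  by apply/ffunP=> j; rewrite !ffunE; case: eqP => // ->.
by rewrite [RHS](reindex_inj (inv_inj swK)).
Qed.

End Resampling.

Section OneStep.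
Context {R : numFieldType} {S : nat}.
Hypothesis S_gt0 : (0 < S)%N.

Let q : R := 1 - S%:R^-1.

Lemma sum_avoid (A : {set 'I_S}) (y : 'I_S) :
  \sum_(f : {ffun 'I_S -> 'I_S}) (y \notin f @: A)%:R =
  q ^+ #|A| *+ #|{: {ffun 'I_S -> 'I_S}}| :> R.
Proof.
have S_neq0 : S%:R != 0 :> R by rewrite pnatr_eq0 -lt0n.
(* Avoiding [y] is a separate condition on each [f x], so the indicator is a product over [x] and
   the sum over [f] factors. A point of [A] contributes [S - 1 = S * q], any other point [S]. *)
pose F (x z : 'I_S) : R := (~~ ((x \in A) && (z == y)))%:R.
transitivity (\sum_(f : {ffun 'I_S -> 'I_S}) \prod_x F x (f x)).
  apply: eq_bigr => f _; case: imsetP => [[x xA yE] | noty] /=.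
    by rewrite (bigD1 x) //= /F xA -yE eqxx mul0r.
  rewrite big1 // => x _; rewrite /F; case: (boolP (x \in A)) => //= xA.
  by case: eqP => // fxy; case: noty; exists x.
rewrite -(bigA_distr_bigA F).
transitivity (\prod_(x : 'I_S) (S%:R * (if x \in A then q else 1))).
  apply: eq_bigr => x _; rewrite /F; case: (x \in A) => /=; last first.
    by rewrite sumr_const card_ord mulr1.
  rewrite (bigD1 y) //= eqxx add0r.
  rewrite (eq_bigr (fun=> 1)) => [|z /negbTE -> //].
  rewrite sumr_const cardC1 card_ord /q mulrBr mulfV // mulr1.
  by rewrite -subn1 natrB.
rewrite big_split /= prodr_const card_ord -big_mkcond /= prodr_const.
by rewrite card_ffun card_ord -[RHS]mulr_natl natrX.
Qed.

Lemma sum_card_imset (A : {set 'I_S}) :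
  \sum_(f : {ffun 'I_S -> 'I_S}) #|f @: A|%:R =
  S%:R * (1 - q ^+ #|A|) *+ #|{: {ffun 'I_S -> 'I_S}}| :> R.
Proof.
transitivity (\sum_(f : {ffun 'I_S -> 'I_S})
    \sum_(y : 'I_S) (1 - (y \notin f @: A)%:R) : R).
  apply: eq_bigr => f _; rewrite -sum1_card natr_sum big_mkcond /=.
  by apply: eq_bigr => y _; case: (y \in _); rewrite /= ?subr0 ?subrr.
rewrite exchange_big /= (eq_bigr (fun=> (1 - q ^+ #|A|)
    *+ #|{: {ffun 'I_S -> 'I_S}}|)) => [|y _].
  by rewrite sumr_const card_ord -[LHS]mulr_natl mulrnAr.
by rewrite sumrB sum_avoid sumr_const mulrnBl.
Qed.

End OneStep.

(* The tangent line at m of the convex function x |-> q `^ x. *)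
Lemma powR_tangent {R : realType} (q m : R) (x : nat) : 0 < q ->
  q `^ m * (1 + (x%:R - m) * ln q) <= q ^+ x.
Proof.
move=> q_gt0; rewrite -powR_mulrn ?(ltW q_gt0) // -{2}(subrKC m x%:R).
rewrite powRD ?(gt_eqF q_gt0) ?implybT //.
(* After cancelling [q ^ m], what remains is [1 + t <= expR t] at [t = (x - m) * ln q]. *)
rewrite ler_pM2l ?powR_gt0 // [leRHS]/powR (gt_eqF q_gt0).
exact: expR_ge1Dx.
Qed.

(** For [S = 1] the base [1 - 1/S] is 0, where the tangent line argument breaks down; this value
    settles that case directly. *)
Lemma a_seq1 (R : realType) m : a_seq R 1 m = 1.
Proof.
by elim: m => //= m ->; rewrite invr1 subrr mulr1 powRr1 // subr0.
Qed.

Lemma sum_card_active_set_le (R : realType) (S n m : nat) :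
  (0 < S)%N -> (m <= n)%N ->
  \sum_(D : diagram S n.+2) #|active_set D m|%:R <=
    a_seq R S m * S%:R * #|{: diagram S n.+2}|%:R.
Proof.
move=> S_gt0; have [-> _ | S_neq1] := eqVneq S 1%N.
  rewrite a_seq1 !mul1r -sum1_card natr_sum ler_sum // => D _.
  by rewrite ler_nat (leq_trans (max_card _)) ?card_ord.
have S_gt1 : (1 < S)%N by rewrite ltn_neqAle eq_sym S_neq1.
elim: m => [|m IHm] ltmn.
  rewrite mul1r (eq_bigr (fun=> S%:R)) => [|D _].
    by rewrite sumr_const mulr_natr.
  by rewrite cardsT card_ord.
pose i : 'I_n := Ordinal ltmn.
set N : R := #|{: diagram S n.+2}|%:R; set q : R := 1 - S%:R^-1.
set mu : R := a_seq R S m * S%:R.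
have N_ge0 : 0 <= N by rewrite ler0n.
have q_gt0 : 0 < q by rewrite subr_gt0 invf_lt1 ?ltr1n ?ltr0n.
have q_le1 : q <= 1 by rewrite gerBl invr_ge0.
have F_neq0 : #|{: {ffun 'I_S -> 'I_S}}|%:R != 0 :> R.
  by rewrite pnatr_eq0 card_ffun card_ord -lt0n expn_gt0 S_gt0.
have step : \sum_(D : diagram S n.+2) #|active_set D m.+1|%:R =
    S%:R * \sum_(D : diagram S n.+2) (1 - q ^+ #|active_set D m|) :> R.
  (* The factor counts the possible values of [D i]: averaging over a resampled [D i] with the lower
     levels fixed reduces the claim to [sum_card_imset]. *)
  apply: (mulIf F_neq0); rewrite mulr_natr.
  rewrite -sumrMnl -(sum_ffun_upd i (fun D => #|active_set D m.+1|%:R)).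
  rewrite mulr_sumr mulr_suml; apply: eq_bigr => D _.
  rewrite mulr_natr -sum_card_imset //; apply: eq_bigr => f _.
  rewrite (active_setS _ i) ffunE eqxx (eq_active_set _ D) // => j ltji.
  by rewrite ffunE; case: eqP ltji => // ->; rewrite ltnn.
rewrite step mulrAC mulrC ler_wpM2r ?ler0n // -/q -/mu.
suff jensen : q `^ mu * N <= \sum_(D : diagram S n.+2) q ^+ #|active_set D m|.
  by rewrite sumrB sumr_const mulrBl mul1r lerB.
(* The tangent is taken at the inductive bound [mu] rather than at the true mean, so convexity and
   monotonicity are used at once. *)
apply: le_trans (ler_sum _ (fun D _ => powR_tangent q mu _ q_gt0)).
rewrite -mulr_sumr ler_pM2l ?powR_gt0 // big_split /= sumr_const.
(* The linear terms add up to a nonnegative amount: [ln q <= 0], and the deviations from [mu] have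
   sum at most 0 by induction. *)
rewrite lerDl -mulr_suml mulr_le0 ?ln_le0 // sumrB sumr_const subr_le0.
by rewrite -[leRHS]mulr_natr IHm // ltnW.
Qed.

Theorem proposition2p3 (R : realType) (S k : nat)
    (S_gt0 : (0 < S)%N) (k_ge2 : (2 <= k)%N) :
  expected_survivors R S k <= a_seq R S k.-2 * S%:R.
Proof.
case: k k_ge2 => [|[|n]] // _; rewrite /expected_survivors.
have N_gt0 : 0 < #|{: diagram S n.+2}|%:R :> R.
  by rewrite ltr0n !card_ffun !card_ord !expn_gt0 S_gt0.
rewrite ler_pdivrMr //.
under eq_bigr do rewrite card_surviving_ancestors.
exact: sum_card_active_set_le.
Qed.
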